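(* Let $\mathcal{P}$ be a PTRS that is orthogonal and spare. Then for each $X\in\{\mathtt{AST},\mathtt{PAST},\mathtt{SAST}\}$: $X(\xrightarrow{\mathbf{f}}_{\mathcal{P}})$ starting in $\mathcal{T}_{\mathcal{B}}$ holds iff $X(\xrightarrow{\mathbf{i}}_{\mathcal{P}})$ starting in $\mathcal{T}_{\mathcal{B}}$ holds.
   Context: Terms $\mathcal{T}$ over countable signature $\Sigma$ and countable variables. $\mathrm{FDist}(A)$: finite multisets of pairs $(p:a)$, $0<p\le1$, probabilities summing to 1; $\mathrm{Supp}(\mu)$, $p\cdot\mu$ as usual. A PTRS: countable set $\mathcal{P}$ of rules $\ell\to\mu$, $\ell$ non-variable, $\mu\in\mathrm{FDist}(\mathcal{T})$, $\mathcal{V}(r)\subseteq\mathcal{V}(\ell)$ for $r\in\mathrm{Supp}(\mu)$. $s\xrightarrow{\mathbf{f}}_{\mathcal{P}}\{p_1:t_1,\dots,p_k:t_k\}$ iff $s|_\pi=\ell\sigma$, $t_j=s[r_j\sigma]_\pi$ for a position $\pi$, rule $\ell\to\{p_1:r_1,\dots,p_k:r_k\}$, substitution $\sigma$; innermost ($\xrightarrow{\mathbf{i}}_{\mathcal{P}}$) if all proper subterms of $\ell\sigma$ are normal forms (terms admitting no step). Defined symbols: roots of left-hand sides; other symbols are constructors; $\mathcal{T}_{\mathcal{B}}$ is the set of basic terms $f(t_1,\dots,t_k)$ with $f$ defined and each $t_i$ built from constructors and variables only. Lifting $\rightrightarrows$ of $\to$: smallest relation on $\mathrm{FDist}(\mathcal{T})$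 with $\{1:t\}\rightrightarrows\{1:t\}$ for $\to$-normal forms, $\{1:t\}\rightrightarrows\mu$ if $t\to\mu$, and $\bigcup_jp_j\cdot\mu_j\rightrightarrows\bigcup_jp_j\cdot\nu_j$ if $\mu_j\rightrightarrows\nu_j$, $\sum p_j=1$. $|\mu|_\to$: probability of normal forms; $\mathrm{edl}((\mu_n))=\sum_n(1-|\mu_n|_\to)$; $\mathrm{edh}_\to(t)=\sup$ of $\mathrm{edl}$ over infinite $\rightrightarrows$-sequences with $\mu_0=\{1:t\}$. ''$\mathtt{AST}(\to)$ starting in $\mathcal{T}_{\mathcal{B}}$'': every infinite $\rightrightarrows$-sequence with $\mu_0=\{1:t\}$, $t\in\mathcal{T}_{\mathcal{B}}$, has $\lim|\mu_n|_\to=1$; ''$\mathtt{PAST}(\to)$ starting in $\mathcal{T}_{\mathcal{B}}$'': every such sequence has finite $\mathrm{edl}$; ''$\mathtt{SAST}(\to)$ starting in $\mathcal{T}_{\mathcal{B}}$'': $\mathrm{edh}_\to(t)<\infty$ for all $t\in\mathcal{T}_{\mathcal{B}}$. Orthogonal: left-linear (no variable twice in a left-hand side) and non-overlapping (no two rules, renamed apart, and non-variable position $\pi$ of the first left-hand side whose subterm unifies with the second left-hand side, with $\pi\ne\varepsilon$ for the same rule). Spare: a $\xrightarrow{\mathbf{f}}_{\mathcal{P}}$-step with rule $\ell\to\mu$ and substitution $\sigma$ is spare if $\sigma(x)$ is a normal form for every variable $x$ occurring more than once in some $r\in\mathrm{Supp}(\mu)$; a $\rightrightarrows$-sequence (lifting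 of $\xrightarrow{\mathbf{f}}_{\mathcal{P}}$) is spare if all its rewrite steps are spare; $\mathcal{P}$ is spare if every such sequence starting with $\{1:t\}$, $t\in\mathcal{T}_{\mathcal{B}}$, is spare. *)

(* Defs.v *)
From HB Require Import structures.
From mathcomp Require Import all_boot all_order all_algebra.
From mathcomp Require Import finmap multiset.
From mathcomp Require Import all_classical all_reals all_analysis.

Set Implicit Arguments.
Unset Strict Implicit.
Unset Printing Implicit Defensive.

Import Order.TTheory GRing.Theory Num.Theory.
Import numFieldNormedType.Exports.

Local Open Scope classical_set_scope.
Local Open Scope ring_scope.
Local Open Scope mset_scope.

Section Terms.
Variables (Sigma : Type) (ar : Sigma -> nat).

Inductive term (V : Type) : Type :=
| Var of V
| App (f : Sigma) of ('I_(ar f) -> term V).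

HB.instance Definition _ (V : Type) := gen_eqMixin (term V).
HB.instance Definition _ (V : Type) := gen_choiceMixin (term V).

Definition is_var (V : Type) (t : term V) : bool :=
  if t is Var _ then true else false.

(* The variables of a term from left to right, with repetitions. *)
Fixpoint vars (V : Type) (t : term V) : seq V :=
  match t with
  | Var x => [:: x]
  | App f a => flatten [seq vars (a i) | i <- enum 'I_(ar f)]
  end.

Fixpoint subst (V W : Type) (sigma : V -> term W) (t : term V) : term W :=
  match t with
  | Var x => sigma x
  | App f a => App (fun i => subst sigma (a i))
  end.

(* Positions are sequences of 0-based argument indices; the result is None
   when pi is not a position of t. *)
Fixpoint subterm_at (V : Type) (t : term V) (pi : seq nat) : option (term V) :=
  match pi with
  | [::] => Some t
  | i :: pi' =>
      match t with
      | Var _ => None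
      | App f a =>
          if insub i is Some j then subterm_at (a (j : 'I_(ar f))) pi' else None
      end
  end.

(* t[u]_pi; only meaningful when pi is a position of t. *)
Fixpoint replace_at (V : Type) (t : term V) (pi : seq nat) (u : term V) :
    term V :=
  match pi with
  | [::] => u
  | i :: pi' =>
      match t with
      | Var _ => t
      | App f a =>
          App (fun j : 'I_(ar f) =>
                 if val j == i then replace_at (a j) pi' u else a j)
      end
  end.

Definition unifiable (V : Type) (s t : term V) : Prop :=
  exists sigma : V -> term V, subst sigma s = subst sigma t.

End Terms.

Section FiniteDistributions.
Variables (R : realType) (A : choiceType).

Definition is_fdist (mu : {mset R * A}) : bool :=
  all (fun x => 0 < x.1 <= 1) mu && (\sum_(x <- mu) x.1 == 1).

Record fdist : Type := FDist {
  fdist_mset :> {mset R * A};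
  fdistP : is_fdist fdist_mset
}.

HB.instance Definition _ := [isSub for fdist_mset].

Definition fdist_supp (mu : fdist) : set A := [set a | exists p, (p, a) \in (mu : {mset R * A})].

Definition scale_fdist (p : R) (mu : fdist) : {mset R * A} :=
  seq_mset [seq (p * x.1, x.2) | x <- mu].

Lemma is_fdist_dirac (a : A) : is_fdist [mset (1, a)].
Proof.
by rewrite /is_fdist enum_msetn /= big_seq1 eqxx ltr01 lexx.
Qed.

Definition dirac_fdist (a : A) : fdist := FDist (is_fdist_dirac a).

Lemma is_fdist_map (g : A -> A) (mu : fdist) :
  is_fdist (seq_mset [seq (x.1, g x.2) | x <- mu]).
Proof.
case: mu => mu /= /andP[/allP mu01 mu1]; apply/andP; split.
  rewrite (perm_all _ (perm_eq_seq_mset _)); apply/allP => _ /mapP[x xmu ->].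
  exact: mu01 xmu.
by rewrite (perm_big _ (perm_eq_seq_mset _)) big_map.
Qed.

(* The multiset image: entries with equal images are not merged. *)
Definition map_fdist (g : A -> A) (mu : fdist) : fdist :=
  FDist (is_fdist_map g mu).

End FiniteDistributions.

Arguments dirac_fdist {R A} a.

Section Lifting.
Variables (R : realType) (T : choiceType) (step : T -> fdist R T -> Prop).

Definition normal_form (t : T) : Prop := ~ exists mu, step t mu.

Inductive lift_rel : fdist R T -> fdist R T -> Prop :=
| lift_nf (t : T) : normal_form t -> lift_rel (dirac_fdist t) (dirac_fdist t)
| lift_step (t : T) (mu : fdist R T) : step t mu -> lift_rel (dirac_fdist t) mu
| lift_union (k : nat) (p : 'I_k -> R) (mus nus : 'I_k -> fdist R T)
    (mu nu : fdist R T) :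
    (forall j, 0 < p j) -> \sum_j p j = 1 ->
    (forall j, lift_rel (mus j) (nus j)) ->
    mu = \big[@msetD _/mset0]_j scale_fdist (p j) (mus j) :> {mset R * T} ->
    nu = \big[@msetD _/mset0]_j scale_fdist (p j) (nus j) :> {mset R * T} ->
    lift_rel mu nu.

Definition lift_seq (t : T) (mu : nat -> fdist R T) : Prop :=
  mu 0%N = dirac_fdist t /\ forall n, lift_rel (mu n) (mu n.+1).

Definition nf_prob (mu : fdist R T) : R :=
  \sum_(x <- mu | `[< normal_form x.2 >]) x.1.

Definition edl (mu : nat -> fdist R T) : \bar R :=
  (\sum_(0 <= n <oo) (1 - nf_prob (mu n))%:E)%E.

Definition edh (t : T) : \bar R := ereal_sup [set edl mu | mu in lift_seq t].

Definition AST (S : set T) : Prop :=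
  forall t, S t -> forall mu, lift_seq t mu ->
  (fun n => nf_prob (mu n)) @ \oo --> (1 : R).

Definition PAST (S : set T) : Prop :=
  forall t, S t -> forall mu, lift_seq t mu -> (edl mu < +oo)%E.

Definition SAST (S : set T) : Prop := forall t, S t -> (edh t < +oo)%E.

End Lifting.

Section PTRS.
Variables (R : realType) (Sigma V : countType) (ar : Sigma -> nat).
Local Notation tm := (term ar V).

Record rule : Type := Rule { lhs : tm; rhs : fdist R tm }.

Implicit Types P : set rule.

Definition is_ptrs P : Prop :=
  countable P /\
  forall rl, P rl -> ~~ is_var (lhs rl) /\
    forall r, fdist_supp (rhs rl) r -> {subset vars r <= vars (lhs rl)}.

(* The data determining a rewrite step of a given term. *)
Record redex : Type := Redex {
  redex_pos : seq nat;
  redex_rule : rule;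
  redex_subst : V -> tm
}.

Definition step_at P (d : redex) (s : tm) (nu : fdist R tm) : Prop :=
  let: Redex pi rl sigma := d in
  [/\ P rl, subterm_at s pi = Some (subst sigma (lhs rl)) &
      nu = map_fdist (fun r => replace_at s pi (subst sigma r)) (rhs rl)].

Definition full_step P (s : tm) (nu : fdist R tm) : Prop :=
  exists d, step_at P d s nu.

Definition innermost_step P (s : tm) (nu : fdist R tm) : Prop :=
  exists2 d, step_at P d s nu &
    forall pi u, pi <> [::] ->
      subterm_at (subst (redex_subst d) (lhs (redex_rule d))) pi = Some u ->
      normal_form (full_step P) u.

Definition defined_symbol P (f : Sigma) : Prop :=
  exists2 rl, P rl & exists a, lhs rl = @App Sigma ar V f a.

Fixpoint constructor_term P (t : tm) : Prop :=
  match t with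
  | Var _ => True
  | App f a => ~ defined_symbol P f /\ forall i, constructor_term P (a i)
  end.

Definition basic_term P : set tm := [set t |
  exists f (a : 'I_(ar f) -> tm),
    [/\ t = App a, defined_symbol P f & forall i, constructor_term P (a i)]].

Definition left_linear P : Prop := forall rl, P rl -> uniq (vars (lhs rl)).

(* Rules are renamed apart by moving their variables into the two summands
   of V + V. *)
Definition non_overlapping P : Prop :=
  forall rl1 rl2, P rl1 -> P rl2 ->
  forall pi u, subterm_at (lhs rl1) pi = Some u -> ~~ is_var u ->
    (rl1 = rl2 -> pi <> [::]) ->
    ~ unifiable (subst (fun x => Var ar (inl x : V + V)) u)
                (subst (fun x => Var ar (inr x : V + V)) (lhs rl2)).

Definition orthogonal_ptrs P : Prop := left_linear P /\ non_overlapping P.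

Definition spare_redex P (d : redex) : Prop :=
  forall r x, fdist_supp (rhs (redex_rule d)) r -> (1 < count_mem x (vars r))%N ->
    normal_form (full_step P) (redex_subst d x).

(* lift_uses P d mu nu: some derivation of lift_rel (full_step P) mu nu performs
   the rewrite step d. *)
Inductive lift_uses P (d : redex) : fdist R tm -> fdist R tm -> Prop :=
| uses_step (t : tm) (nu : fdist R tm) :
    step_at P d t nu -> lift_uses P d (dirac_fdist t) nu
| uses_union (k : nat) (p : 'I_k -> R) (mus nus : 'I_k -> fdist R tm)
    (mu nu : fdist R tm) (j0 : 'I_k) :
    (forall j, 0 < p j) -> \sum_j p j = 1 ->
    (forall j, lift_rel (full_step P) (mus j) (nus j)) ->
    mu = \big[@msetD _/mset0]_j scale_fdist (p j) (mus j) :> {mset R * tm} ->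
    nu = \big[@msetD _/mset0]_j scale_fdist (p j) (nus j) :> {mset R * tm} ->
    lift_uses P d (mus j0) (nus j0) ->
    lift_uses P d mu nu.

Definition spare_seq P (mu : nat -> fdist R tm) : Prop :=
  forall n d, lift_uses P d (mu n) (mu n.+1) -> spare_redex P d.

Definition spare P : Prop :=
  forall t, basic_term P t ->
  forall mu, lift_seq (full_step P) t mu -> spare_seq P mu.

End PTRS.

(* Main.v *)
(** Fix for every reducible term one innermost step and let [term_prob n s] be the probability that
    the resulting innermost strategy reaches a normal form from [s] within [n] steps. Distinct
    innermost redexes of an orthogonal system are parallel, so [term_prob] does not depend on the
    chosen steps. If a full step takes [s] to [nu], then
    [term_prob n.+1 s <= expect nu (term_prob n)]: an innermost redex of [s] is either parallel to
    the contracted redex, or lies in the instance of a variable, and then spareness says that the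
    contraction keeps at most one copy of it, so postponing the innermost step never lengthens the
    computation. Iterating along a rewrite sequence [mu] from a basic term [t], the probability that
    [mu n] is a normal form is at least that of the [n]-th element of the innermost run from [t].
    Hence that single run decides AST, PAST and SAST of full rewriting. *)

Require Import Defs.
From mathcomp Require Import all_boot all_order all_algebra.
From mathcomp Require Import finmap multiset.
From mathcomp Require Import all_classical all_reals all_analysis.

Set Implicit Arguments.
Unset Strict Implicit.
Unset Printing Implicit Defensive.

Import Order.TTheory GRing.Theory Num.Theory.
Import numFieldNormedType.Exports.

Local Open Scope classical_set_scope.
Local Open Scope ring_scope.
Local Open Scope mset_scope.

(** * Positions, parallel replacement and substitution in terms *)

Section Positions.
Variables (Sigma : Type) (ar : Sigma -> nat).
Implicit Types (V W : Type) (p q : seq nat).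

(* [subterm_at] and [replace_at] recurse on the term, so they do not reduce
   at the root position of an opaque term. *)
Lemma subterm_at_nil V (s : term ar V) : subterm_at s [::] = Some s.
Proof. by case: s. Qed.

Lemma replace_at_nil V (s u : term ar V) : replace_at s [::] u = u.
Proof. by case: s. Qed.

Lemma subterm_at_cat V (s : term ar V) p q :
  subterm_at s (p ++ q) = obind (fun u => subterm_at u q) (subterm_at s p).
Proof.
elim: p s => [|i p IH] [x|f a] //=.
by case: insubP => [j _ _|//]; exact: IH.
Qed.

Lemma subterm_at_arg V (f : Sigma) (a : 'I_(ar f) -> term ar V) i p :
  subterm_at (App a) (val i :: p) = subterm_at (a i) p.
Proof. by rewrite /= valK. Qed.

Lemma subterm_at_App V (f : Sigma) (a : 'I_(ar f) -> term ar V) k p u :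
  subterm_at (App a) (k :: p) = Some u ->
  exists2 i, k = val i & subterm_at (a i) p = Some u.
Proof. by move=> /=; case: insubP => [i _ <- h|//]; exists i. Qed.

Lemma replace_at_arg V (f : Sigma) (a : 'I_(ar f) -> term ar V) i p u :
  replace_at (App a) (val i :: p) u =
  App (fun j => if j == i then replace_at (a i) p u else a j).
Proof.
congr App; apply: funext => j /=; rewrite (val_eqE j i).
by case: eqVneq => [->|].
Qed.

Lemma replace_at_cat V (s u v : term ar V) p q :
  subterm_at s p = Some u ->
  replace_at s (p ++ q) v = replace_at s p (replace_at u q v).
Proof.
elim: p s => [|k p IH] s.
  by rewrite subterm_at_nil !replace_at_nil => -[->].
case: s => [//|f a] /subterm_at_App[i -> h] /=; congr App; apply: funext => j.
by case: eqVneq => // /val_inj ->; exact: IH.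
Qed.

Lemma subterm_at_replace V (s u v : term ar V) p :
  subterm_at s p = Some u -> subterm_at (replace_at s p v) p = Some v.
Proof.
elim: p s => [|k p IH] s; first by rewrite replace_at_nil !subterm_at_nil.
case: s => [//|f a].
by case/subterm_at_App => i -> /IH h; rewrite replace_at_arg subterm_at_arg eqxx.
Qed.

Lemma replace_atK V (s u v : term ar V) p :
  replace_at (replace_at s p u) p v = replace_at s p v.
Proof.
elim: p s => [|k p IH] s; first by rewrite !replace_at_nil.
case: s => [//|f a] /=; congr App; apply: funext => j.
by case: eqVneq => // _; exact: IH.
Qed.

Definition parallel p q := ~~ prefix p q && ~~ prefix q p.

Lemma parallelC p q : parallel p q = parallel q p.
Proof. exact: andbC. Qed.

Lemma subterm_at_parallel V (s u : term ar V) p q :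
  parallel p q -> subterm_at (replace_at s p u) q = subterm_at s q.
Proof.
elim: p q s => [|k p IH] [|l q] s; rewrite /parallel ?prefix0s ?andbF //.
case: s => [//|f a] /=.
case: insubP => [i _ vi|//]; rewrite vi (eq_sym l).
by case: eqVneq => //= _; exact: IH.
Qed.

Lemma replace_at_parallel V (s u v : term ar V) p q :
  parallel p q ->
  replace_at (replace_at s p u) q v = replace_at (replace_at s q v) p u.
Proof.
elim: p q s => [|k p IH] [|l q] s; rewrite /parallel ?prefix0s ?andbF //.
case: s => [//|f a] /= h; congr App; apply: funext => j.
case: (eqVneq (val j) l) => jl; case: (eqVneq (val j) k) => jk //=.
by apply: IH; move: h; rewrite -jl -jk eqxx.
Qed.

Lemma subst_comp V W (X : Type) (sg : V -> term ar W) (th : W -> term ar X) t :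
  subst th (subst sg t) = subst (fun x => subst th (sg x)) t.
Proof. by elim: t => [//|f a IH] /=; congr App; apply: funext => i; exact: IH. Qed.

Lemma subterm_at_subst V W (sg : V -> term ar W) t p u :
  subterm_at t p = Some u -> subterm_at (subst sg t) p = Some (subst sg u).
Proof.
elim: p t => [t|k p IH [x//|f a]]; first by rewrite !subterm_at_nil => -[->].
by case/subterm_at_App => i -> /IH h; rewrite /= valK.
Qed.

(** Descending along [p] either stays on function symbols of [t] or meets a variable of [t]; a
    position that is exactly a variable position falls under the second case, with [p2] empty. This
    separates overlaps from redexes inside the substitution. *)
Lemma subterm_at_subst_inv V W (sg : V -> term ar W) t p u :
  subterm_at (subst sg t) p = Some u ->
  (exists2 v, subterm_at t p = Some v & ~~ is_var v /\ u = subst sg v) \/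
  (exists x p1 p2, [/\ p = p1 ++ p2, subterm_at t p1 = Some (Var ar x) &
                       subterm_at (sg x) p2 = Some u]).
Proof.
elim: p t => [|k p IH] [x|f a]; try by right; exists x, [::]; eexists.
  by move=> /= [<-]; left; exists (App a).
case/subterm_at_App => i -> /IH[[v h1 h2]|[x [p1 [p2 [-> h1 h2]]]]].
  by left; exists v; rewrite // subterm_at_arg.
by right; exists x, (val i :: p1), p2; rewrite subterm_at_arg.
Qed.

End Positions.

(** * Variable occurrences and linear substitution *)

Section VariableOccurrences.
Variables (Sigma : Type) (ar : Sigma -> nat) (V : eqType).

Lemma vars_App (f : Sigma) (a : 'I_(ar f) -> term ar V) x :
  (x \in vars (App a)) = [exists i, x \in vars (a i)].
Proof.
apply/flatten_mapP/existsP => [[i _ h]|[i h]]; first by exists i.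
by exists i; rewrite // mem_enum.
Qed.

Lemma count_vars_App (f : Sigma) (a : 'I_(ar f) -> term ar V) x :
  count_mem x (vars (App a)) = (\sum_i count_mem x (vars (a i)))%N.
Proof. by rewrite /= count_flatten sumnE -map_comp big_map big_enum. Qed.

Lemma eq_in_subst W (sg th : V -> term ar W) t :
  {in vars t, sg =1 th} -> subst sg t = subst th t.
Proof.
elim: t => [x|f a IH] h /=; first by apply: h; rewrite inE.
congr App; apply: funext => i; apply: IH => x xi; apply: h.
by rewrite vars_App; apply/existsP; exists i.
Qed.

Lemma subst_inj W (sg th : V -> term ar W) t :
  subst sg t = subst th t -> {in vars t, sg =1 th}.
Proof.
elim: t => [x|f a IH] h y; first by rewrite inE => /eqP ->.
rewrite vars_App => /existsP[i]; apply: IH.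
(* Reading off the [i]-th argument with [subterm_at] avoids inverting an equality between
   dependently typed applications. *)
have := congr1 (fun t => subterm_at t [:: val i]) h.
by rewrite /= !valK !subterm_at_nil => -[].
Qed.

Lemma vars_subterm (t : term ar V) x p :
  subterm_at t p = Some (Var ar x) -> x \in vars t.
Proof.
elim: p t => [t|k p IH [//|f a]]; first by rewrite subterm_at_nil => -[->]; rewrite inE.
move=> h0; have [i _ /IH h] := subterm_at_App h0.
by rewrite vars_App; apply/existsP; exists i.
Qed.

Lemma vars_subtermP (t : term ar V) x :
  x \in vars t -> exists p, subterm_at t p = Some (Var ar x).
Proof.
elim: t => [y|f a IH]; first by rewrite inE => /eqP ->; exists [::].
rewrite vars_App => /existsP[i /IH[p h]]; exists (val i :: p).
by rewrite subterm_at_arg.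
Qed.

(** With a single occurrence of [x], changing the substitution at [x] alone amounts to one
    replacement. A step inside [sg x] thus becomes a single step of the instance. *)
Lemma subst_linear W (sg th : V -> term ar W) (t : term ar V) x p :
  (forall y, y != x -> sg y = th y) ->
  (count_mem x (vars t) <= 1)%N -> subterm_at t p = Some (Var ar x) ->
  subst th t = replace_at (subst sg t) p (th x).
Proof.
move=> sgth; elim: t p => [y|f a IH] [|k p] //; first by rewrite replace_at_nil => _ [->].
rewrite count_vars_App => c1 h0; have [i -> h] := subterm_at_App h0.
have xi := vars_subterm h.
move: c1; rewrite (bigD1 i)//=.
have : (0 < count_mem x (vars (a i)))%N by rewrite -has_count has_pred1.
case c: (count_mem x (vars (a i))) => [//|[|//]] _; rewrite add1n ltnS leqn0.
rewrite sum_nat_eq0 => /forallP hs.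
congr App; apply: funext => j; case: eqVneq => [/val_inj ->|ji].
  by apply: IH => //; rewrite c.
apply: eq_in_subst => y yj; apply/esym/sgth; apply: contraTneq yj => ->.
have := hs j; rewrite -val_eqE ji /= => /eqP h1.
by rewrite -has_pred1 has_count h1.
Qed.

End VariableOccurrences.

(** * Expectations over finite distributions *)

Section Expectation.
Variables (R : realType) (T : choiceType).
Implicit Types (mu nu : fdist R T) (f g : T -> R).

Lemma fdist_supp_map (h : T -> T) mu y :
  fdist_supp (map_fdist h mu) y <-> exists2 x, fdist_supp mu x & y = h x.
Proof.
split=> [[p]|[x [p px] ->]].
  rewrite (perm_mem (perm_eq_seq_mset _)) => /mapP[[q x] qx [_ ->]].
  by exists x => //; exists q.
exists p; rewrite (perm_mem (perm_eq_seq_mset _)).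
by apply/mapP; exists (p, x).
Qed.

Lemma eq_map_fdist (h k : T -> T) mu :
  (forall x, fdist_supp mu x -> h x = k x) -> map_fdist h mu = map_fdist k mu.
Proof.
move=> hk; apply: val_inj; congr seq_mset.
by apply/eq_in_map => -[p x] px /=; rewrite hk//; exists p.
Qed.

Lemma fdist_ge0 mu x : x \in (mu : {mset _}) -> 0 < x.1.
Proof. by case/andP: (fdistP mu) => /allP h _ /h/andP[]. Qed.

Lemma fdist_sum1 mu : \sum_(x <- mu) x.1 = 1.
Proof. by case/andP: (fdistP mu) => _ /eqP. Qed.

Definition expect mu f : R := \sum_(x <- mu) x.1 * f x.2.

Lemma expect_map (h : T -> T) mu f :
  expect (map_fdist h mu) f = expect mu (fun x => f (h x)).
Proof. by rewrite /expect (perm_big _ (perm_eq_seq_mset _)) big_map. Qed.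

Lemma expect_dirac x f : expect (dirac_fdist x) f = f x.
Proof. by rewrite /expect enum_msetn /= big_seq1 mul1r. Qed.

Lemma le_expect mu f g : (forall x, fdist_supp mu x -> f x <= g x) ->
  expect mu f <= expect mu g.
Proof.
move=> fg; rewrite /expect big_seq [leRHS]big_seq; apply: ler_sum => -[p x] px /=.
by rewrite ler_pM2l ?fg//; [exists p|exact: (fdist_ge0 px)].
Qed.

Lemma eq_expect mu f g : (forall x, fdist_supp mu x -> f x = g x) ->
  expect mu f = expect mu g.
Proof.
move=> fg; apply/eqP; rewrite eq_le.
by apply/andP; split; apply: le_expect => x /fg ->.
Qed.

Lemma expect_cst mu c : expect mu (fun=> c) = c.
Proof. by rewrite /expect -mulr_suml fdist_sum1 mul1r. Qed.

Lemma expect_exchange mu nu (f : T -> T -> R) :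
  expect mu (fun x => expect nu (f x)) =
  expect nu (fun y => expect mu (f^~ y)).
Proof.
rewrite /expect; under eq_bigr do rewrite mulr_sumr.
rewrite exchange_big; apply: eq_bigr => y _; rewrite mulr_sumr.
by apply: eq_bigr => x _; rewrite mulrCA.
Qed.

Lemma mem_scale_fdist p mu y :
  y \in scale_fdist p mu -> exists2 x, x \in (mu : {mset _}) & y = (p * x.1, x.2).
Proof. by rewrite (perm_mem (perm_eq_seq_mset _)) => /mapP. Qed.

(** Reduces sums over and membership in a multiset union to a concatenation of lists. *)
Lemma perm_bigmsetD k (B : 'I_k -> {mset R * T}) :
  perm_eq (\big[@msetD _/mset0]_j B j) (flatten [seq (B j : seq _) | j <- index_enum 'I_k]).
Proof.
elim: (index_enum _) => [|j s IH].
  by rewrite big_nil /= enum_mset0.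
rewrite big_cons /=; apply/allP => x _; apply/eqP.
by rewrite count_mem_mset msetE2 count_cat count_mem_mset -(permP IH) count_mem_mset.
Qed.

Lemma expect_union k (p : 'I_k -> R) (mus : 'I_k -> fdist R T) mu f :
  mu = (\big[@msetD _/mset0]_j scale_fdist (p j) (mus j)) :> {mset R * T} ->
  expect mu f = \sum_j p j * expect (mus j) f.
Proof.
rewrite /expect => ->; rewrite (perm_big _ (perm_bigmsetD _)) big_flatten.
rewrite big_map; apply: eq_bigr => j _.
rewrite (perm_big _ (perm_eq_seq_mset _)) big_map mulr_sumr.
by apply: eq_bigr => x _; rewrite mulrA.
Qed.

Lemma fdist_supp_union k (p : 'I_k -> R) (mus : 'I_k -> fdist R T) mu y :
  mu = (\big[@msetD _/mset0]_j scale_fdist (p j) (mus j)) :> {mset R * T} ->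
  fdist_supp mu y <-> exists j, fdist_supp (mus j) y.
Proof.
rewrite /fdist_supp /= => ->; split=> [[q]|[j [q qy]]].
  rewrite (perm_mem (perm_bigmsetD _)) => /flatten_mapP[j _].
  by case/mem_scale_fdist => -[q' x] h [_ ->]; exists j, q'.
exists (p j * q); rewrite (perm_mem (perm_bigmsetD _)).
apply/flatten_mapP; exists j; first exact: mem_index_enum.
rewrite (perm_mem (perm_eq_seq_mset _)).
by apply/mapP; exists (q, y).
Qed.

Lemma nf_probE (step : T -> fdist R T -> Prop) mu :
  nf_prob step mu = expect mu (fun x => (`[< normal_form step x >])%:R).
Proof.
rewrite /nf_prob /expect big_mkcond; apply: eq_bigr => x _ /=.
by case: ifP; rewrite ?mulr1 ?mulr0.
Qed.

Lemma nf_prob_le1 (step : T -> fdist R T -> Prop) mu : nf_prob step mu <= 1.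
Proof.
rewrite nf_probE -[leRHS](expect_cst mu); apply: le_expect => x _.
by case: asbool; rewrite ?ler01.
Qed.

End Expectation.

(** * Normal forms, orthogonality and commutation of steps *)

Section Rewriting.
Variables (R : realType) (Sigma V : countType) (ar : Sigma -> nat).
Local Notation tm := (term ar V).
Variable P : set (rule R V ar).
Implicit Types (s t u : tm) (rl : rule R V ar) (d : redex R V ar).

Definition inner_redex d : Prop :=
  forall pi u, pi <> [::] ->
    subterm_at (subst (redex_subst d) (lhs (redex_rule d))) pi = Some u ->
    normal_form (full_step P) u.

Lemma nf_subterm s p u : normal_form (full_step P) s ->
  subterm_at s p = Some u -> normal_form (full_step P) u.
Proof.
move=> nfs su [nu [[pi rl sg] [Prl usub _]]]; apply: nfs.
eexists; exists (Redex (p ++ pi) rl sg); split; [by []| |by []].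
by rewrite subterm_at_cat su.
Qed.

Lemma innermost_full s nu : innermost_step P s nu -> full_step P s nu.
Proof. by case=> d sd _; exists d. Qed.

(** Structural induction: if some argument is reducible, an innermost redex is found inside it;
    otherwise the given redex must be at the root and all its proper subterms are normal. *)
Lemma full_innermost s :
  (exists nu, full_step P s nu) -> exists nu, innermost_step P s nu.
Proof.
elim: s => [x|f a IH] [nu [[pi rl sg] h]].
  exists nu, (Redex pi rl sg) => //.
  by case: pi h => [|k p] [_] //= [<-] _ [|k p].
case: (pselect (exists i nu, full_step P (a i) nu)) => [[i /IH]|nai].
  case=> nu' [[p' rl' sg'] [Prl' sub' _] inn'].
  eexists; exists (Redex (val i :: p') rl' sg'); last exact: inn'.
  by split; [by []| rewrite subterm_at_arg|by []].
have {}nai i : normal_form (full_step P) (a i).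
  by move=> [nu' h']; apply: nai; exists i, nu'.
exists nu, (Redex pi rl sg) => //.
case: pi h => [|k p] [Prl]; last first.
  move=> h _; have [i _ sub] := subterm_at_App h; exfalso.
  apply: (nf_subterm (nai i) sub); eexists.
  by exists (Redex [::] rl sg); split; [by []|rewrite subterm_at_nil|by []].
rewrite subterm_at_nil => -[<-] _ [//|k p] u _ h.
by have [i _] := subterm_at_App h; exact: nf_subterm.
Qed.

Lemma nf_innermost : normal_form (innermost_step P) = normal_form (full_step P).
Proof.
apply: funext => s; apply: propext; split=> h.
  by move=> /full_innermost.
by case=> nu /innermost_full nus; apply: h; exists nu.
Qed.

Hypothesis ptrs : is_ptrs P.
Hypothesis orth : orthogonal_ptrs P.

(** Since the rules are renamed apart, [sg1] and [sg2] glue to one unifier, which non-overlap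
    forbids except for a rule with itself at the root. *)
Lemma overlap rl1 rl2 pi v (sg1 sg2 : V -> tm) : P rl1 -> P rl2 ->
  subterm_at (lhs rl1) pi = Some v -> ~~ is_var v ->
  subst sg1 v = subst sg2 (lhs rl2) -> rl1 = rl2 /\ pi = [::].
Proof.
move=> P1 P2 sub nv e; apply: contrapT => no.
have no' : rl1 = rl2 -> pi <> [::] by move=> e1 e2; exact: no.
apply: (orth.2 _ _ P1 P2 _ _ sub nv no').
(* The unifier must take values in terms over [V + V]; embedding them through [inl] is an arbitrary
   choice. *)
pose emb := subst (fun x : V => Var ar (inl x : V + V)).
exists (fun z => match z with inl x => emb (sg1 x) | inr x => emb (sg2 x) end).
by rewrite !subst_comp /= -!subst_comp e.
Qed.

(** Non-overlap forces the same rule; the substitutions then agree on the variables of the left-hand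
    side, hence on those of every right-hand side. *)
Lemma step_at_unique pi rl1 rl2 sg1 sg2 s nu1 nu2 :
  step_at P (Redex pi rl1 sg1) s nu1 -> step_at P (Redex pi rl2 sg2) s nu2 ->
  nu1 = nu2.
Proof.
move=> [P1 e1 ->] [P2]; rewrite e1 => -[e2] ->.
have [nv1 vs1] := ptrs.2 _ P1.
have [e _] := overlap P1 P2 (subterm_at_nil _) nv1 e2.
move: e2; rewrite -e => e2; apply: eq_map_fdist => r rr; congr replace_at.
by apply: eq_in_subst => x /(vs1 _ rr); exact: subst_inj.
Qed.

(** If [pi] were strictly below [tau], the redex at [tau] would not be innermost. If [tau] is below
    [pi], it cannot lie at a function symbol of the left-hand side without an overlap, so it lies in
    the instance of a variable. *)
Lemma inner_position pi tau rl1 rl2 sg1 sg2 s nu1 nu2 :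
  step_at P (Redex pi rl1 sg1) s nu1 -> step_at P (Redex tau rl2 sg2) s nu2 ->
  inner_redex (Redex tau rl2 sg2) -> pi <> tau ->
  parallel pi tau \/
  exists x q1 q2, [/\ tau = pi ++ q1 ++ q2,
    subterm_at (lhs rl1) q1 = Some (Var ar x) &
    subterm_at (sg1 x) q2 = Some (subst sg2 (lhs rl2))].
Proof.
move=> [P1 e1 _] [P2 e2 _] inn ne.
case: (boolP (prefix pi tau)) => [/prefixP[q eq]|np1].
  right; move: e2; rewrite eq subterm_at_cat e1 /= => e2.
  have [[v sv [nv ev]]|[x [q1 [q2 [-> h1 h2]]]]] := subterm_at_subst_inv e2.
    have [_ q0] := overlap P1 P2 sv nv (esym ev).
    by case: ne; rewrite eq q0 cats0.
  by exists x, q1, q2.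
case: (boolP (prefix tau pi)) => [/prefixP[q eq]|np2]; last first.
  by left; rewrite /parallel np1 np2.
exfalso; move: e1; rewrite eq subterm_at_cat e2 /= => e1.
have q0 : q <> [::] by move=> q0; apply: ne; rewrite eq q0 cats0.
apply: (inn q _ q0 e1); eexists.
by exists (Redex [::] rl1 sg1); split; [by []|rewrite subterm_at_nil|by []].
Qed.

Lemma step_at_parallel pi tau rl1 rl2 sg1 sg2 s nu1 nu2 :
  step_at P (Redex pi rl1 sg1) s nu1 -> step_at P (Redex tau rl2 sg2) s nu2 ->
  parallel pi tau ->
  let g1 r := replace_at s pi (subst sg1 r) in
  let g2 r := replace_at s tau (subst sg2 r) in
  let G r1 r2 := replace_at (g1 r1) tau (subst sg2 r2) in
  (forall r, step_at P (Redex tau rl2 sg2) (g1 r) (map_fdist (G r) (rhs rl2))) /\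
  (forall r, step_at P (Redex pi rl1 sg1) (g2 r) (map_fdist (G^~ r) (rhs rl1))).
Proof.
move=> [P1 e1 _] [P2 e2 _] par /=; split=> r; split=> //.
- by rewrite subterm_at_parallel.
- by rewrite subterm_at_parallel // parallelC.
- by apply: eq_map_fdist => r1 _; rewrite replace_at_parallel.
Qed.

(** Distinct innermost redexes are parallel, as nesting would put a redex properly inside an
    innermost one. Both orders of contraction therefore meet in the common results [G r1 r2]. *)
Lemma inner_diamond d1 d2 s nu1 nu2 :
  step_at P d1 s nu1 -> step_at P d2 s nu2 ->
  inner_redex d1 -> inner_redex d2 ->
  nu1 = nu2 \/
  exists G mu1 g1 mu2 g2,
    [/\ nu1 = map_fdist g1 mu1, nu2 = map_fdist g2 mu2,
        forall r, innermost_step P (g1 r) (map_fdist (G r) mu2) &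
        forall r, innermost_step P (g2 r) (map_fdist (G^~ r) mu1)].
Proof.
case: d1 => pi rl1 sg1; case: d2 => tau rl2 sg2 s1 s2 i1 i2.
have [e|/eqP ne] := eqVneq pi tau.
  by left; rewrite e in s1; exact: step_at_unique s1 s2.
right; have [par|[x [q1 [q2 [_ h1 h2]]]]] := inner_position s1 s2 i2 ne.
  have [G1 G2] := step_at_parallel s1 s2 par.
  case: (s1) => _ _ ->; case: (s2) => _ _ ->.
  by do 5!eexists; split=> [||r|r]; [by []|by []|eexists; [exact: G1|]|eexists; [exact: G2|]].
exfalso; case: (s1) => P1 e1 _; case: (s2) => P2 e2 _.
have sub : subterm_at (subst sg1 (lhs rl1)) (q1 ++ q2) = Some (subst sg2 (lhs rl2)).
  by rewrite subterm_at_cat (subterm_at_subst _ h1).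
have q0 : q1 ++ q2 <> [::].
  move=> q0; have := (ptrs.2 _ P1).1.
  by case: (q1) q0 h1 => // _; rewrite subterm_at_nil => -[->].
apply: (i1 _ _ q0 sub); eexists.
by exists (Redex [::] rl2 sg2); split; [by []|rewrite subterm_at_nil|by []].
Qed.

(** Here [d2] may be nested in the instance of a variable matched by [d1]. Contracting [d1] then
    erases that redex, so [G r] is constant, or keeps exactly one copy of it, which one innermost
    step contracts. *)
Lemma spare_commute d1 d2 s nu1 nu2 :
  step_at P d1 s nu1 -> step_at P d2 s nu2 ->
  spare_redex P d1 -> inner_redex d2 ->
  nu1 = nu2 \/
  exists G mu1 g1 mu2 g2,
    [/\ nu1 = map_fdist g1 mu1, nu2 = map_fdist g2 mu2,
        forall r, fdist_supp mu1 r -> (forall r', G r r' = g1 r) \/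
          innermost_step P (g1 r) (map_fdist (G r) mu2) &
        forall r, full_step P (g2 r) (map_fdist (G^~ r) mu1)].
Proof.
case: d1 => pi rl1 sg1; case: d2 => tau rl2 sg2 s1 s2 i1 i2.
have [e|/eqP ne] := eqVneq pi tau.
  by left; rewrite e in s1; exact: step_at_unique s1 s2.
right; have [par|[x [q1 [q2 [etau h1 h2]]]]] := inner_position s1 s2 i2 ne.
  have [G1 G2] := step_at_parallel s1 s2 par.
  case: (s1) => _ _ ->; case: (s2) => _ _ ->.
  do 5!eexists; split=> [||r _|r]; [by []|by []| |by eexists; exact: G2].
  by right; eexists; [exact: G1|].
case: (s1) => P1 e1 ->; case: (s2) => P2 e2 ->.
(* The substitution [sg1] after the inner step has been carried out inside [sg1 x] with outcome
   [r']. *)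
pose sgx r' y := if y == x then replace_at (sg1 x) q2 (subst sg2 r') else sg1 y.
have sgx_x r' : sgx r' x = replace_at (sg1 x) q2 (subst sg2 r') by rewrite /sgx eqxx.
have sgx_ne r' y : y != x -> sg1 y = sgx r' y by rewrite /sgx => /negPf ->.
have sgxE t q r' : (count_mem x (vars t) <= 1)%N ->
    subterm_at t q = Some (Var ar x) ->
    subst (sgx r') t = replace_at (subst sg1 t) (q ++ q2) (subst sg2 r').
  move=> c1 sub; rewrite (subst_linear (sgx_ne r') c1 sub) sgx_x.
  by rewrite -(replace_at_cat _ _ (subterm_at_subst sg1 sub)).
exists (fun r r' => replace_at s pi (subst (sgx r') r)).
exists (rhs rl1), (fun r => replace_at s pi (subst sg1 r)).
exists (rhs rl2), (fun r => replace_at s tau (subst sg2 r)).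
split=> // r.
  move=> rr; have [xr|xr] := boolP (x \in vars r); last first.
    left=> r'; congr replace_at; apply: eq_in_subst => y yr.
    by rewrite -sgx_ne //; apply: contraNneq xr => <-.
  right; have [q hq] := vars_subtermP xr.
  have c1 : (count_mem x (vars r) <= 1)%N.
    (* A second occurrence of [x] in [r] would, by spareness, make [sg1 x] normal, yet it contains
       the redex of [d2]. *)
    rewrite leqNgt; apply/negP => c2; apply: (nf_subterm (i1 _ _ rr c2) h2).
    by eexists; exists (Redex [::] rl2 sg2); split; [by []|rewrite subterm_at_nil|by []].
  have subpi := subterm_at_replace (subst sg1 r) e1.
  exists (Redex (pi ++ q ++ q2) rl2 sg2) => //; split=> //.
    by rewrite subterm_at_cat subpi /= subterm_at_cat (subterm_at_subst _ hq).
  apply: eq_map_fdist => r' _; rewrite (replace_at_cat _ _ subpi) replace_atK.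
  by rewrite (sgxE _ _ _ c1 hq).
exists (Redex pi rl1 (sgx r)).
(* Left-linearity ensures that the term is still an instance of [lhs rl1] after the inner step, now
   by [sgx r]. *)
have c1 : (count_mem x (vars (lhs rl1)) <= 1)%N.
  by rewrite count_uniq_mem ?leq_b1//; exact: orth.1.
rewrite etau (replace_at_cat _ _ e1) -(sgxE _ _ _ c1 h1); split=> //.
  exact: subterm_at_replace e1.
by apply: eq_map_fdist => r' _; rewrite replace_atK.
Qed.

End Rewriting.

(** * Kleisli extension of distributions and runs of a strategy *)

Section Strategies.
Variables (R : realType) (T : choiceType).
Implicit Types (mu nu : fdist R T) (step : T -> fdist R T -> Prop).

Lemma is_fdist_union k (p : 'I_k -> R) (nus : 'I_k -> fdist R T) :
  (forall j, 0 < p j) -> \sum_j p j = 1 ->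
  is_fdist (\big[@msetD _/mset0]_j scale_fdist (p j) (nus j)).
Proof.
move=> p0 p1; apply/andP; split.
  rewrite (perm_all _ (perm_bigmsetD _)); apply/allP => y /flatten_mapP[j _].
  case/mem_scale_fdist => x xj -> /=; rewrite mulr_gt0 //=; last exact: fdist_ge0 xj.
  have pj1 : p j <= 1.
    by rewrite -p1 (bigD1 j) //= lerDl sumr_ge0 // => i _; exact: ltW.
  have /andP[/allP/(_ _ xj)/andP[x0 x1] _] := fdistP (nus j).
  by rewrite mulr_ile1 // ltW.
rewrite (perm_big _ (perm_bigmsetD _)) big_flatten big_map -p1.
apply/eqP/eq_bigr => j _.
rewrite (perm_big _ (perm_eq_seq_mset _)) big_map -mulr_sumr.
by rewrite fdist_sum1 mulr1.
Qed.

Local Notation entry mu := (tnth (in_tuple (fdist_mset mu))).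

Lemma entry_gt0 mu j : 0 < (entry mu j).1.
Proof. exact/fdist_ge0/mem_tnth. Qed.

Lemma sum_entry mu : \sum_j (entry mu j).1 = 1.
Proof. by rewrite -(fdist_sum1 mu) [RHS]big_tnth. Qed.

Definition bind_fdist mu (g : T -> fdist R T) : fdist R T :=
  FDist (is_fdist_union (fun j => g (entry mu j).2) (@entry_gt0 mu) (sum_entry mu)).

(** Splits [mu] into the convex combination of its entries, the form that [lift_union] asks of its
    source. *)
Lemma bind_dirac mu :
  fdist_mset mu = \big[@msetD _/mset0]_j
    scale_fdist (entry mu j).1 (dirac_fdist (entry mu j).2).
Proof.
rewrite -[LHS]seq_mset_id -[RHS]seq_mset_id; apply/eq_seq_msetP.
rewrite perm_sym; apply: perm_trans (perm_bigmsetD _) _.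
have E (x : R * T) : enum_mset (scale_fdist x.1 (dirac_fdist x.2)) = [:: x].
  rewrite /scale_fdist enum_msetn /= mulr1; apply: perm_small_eq => //.
  by rewrite (perm_trans (perm_eq_seq_mset _)) //; case: x.
under eq_map do rewrite E.
by rewrite flatten_map1 [index_enum _]unlock -enumT map_tnth_enum.
Qed.

Lemma expect_bind mu g f :
  expect (bind_fdist mu g) f = expect mu (fun x => expect (g x) f).
Proof.
rewrite (@expect_union _ _ _ _ _ (bind_fdist mu g) _ erefl).
by rewrite [RHS]big_tnth.
Qed.

Lemma fdist_supp_bind mu g y :
  fdist_supp (bind_fdist mu g) y <-> exists2 x, fdist_supp mu x & fdist_supp (g x) y.
Proof.
split=> [/(@fdist_supp_union _ _ _ _ _ (bind_fdist mu g) y erefl)[j yj]|].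
  exists (entry mu j).2 => //; exists (entry mu j).1.
  by rewrite -surjective_pairing; exact: mem_tnth.
case=> x [p px] yx.
apply/(@fdist_supp_union _ _ _ _ _ (bind_fdist mu g) y erefl).
by have [j jE] := seq_tnthP px; exists j; rewrite -jE.
Qed.

Lemma lift_bind step mu g :
  (forall x, fdist_supp mu x -> lift_rel step (dirac_fdist x) (g x)) ->
  lift_rel step mu (bind_fdist mu g).
Proof.
move=> h; apply: (lift_union (@entry_gt0 mu) (sum_entry mu) _ (bind_dirac mu)) => [j|//].
apply: h; exists (entry mu j).1.
by rewrite -surjective_pairing; exact: mem_tnth.
Qed.

(** A choice of one step per reducible term. The Dirac default on normal forms agrees with
    [lift_nf], so runs are lifted sequences. *)
Definition strategy step (x : T) : fdist R T :=
  if pselect (exists nu, step x nu) is left h then projT1 (cid h)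
  else dirac_fdist x.

Lemma strategy_nf step x : normal_form step x -> strategy step x = dirac_fdist x.
Proof. by rewrite /strategy; case: pselect. Qed.

Lemma strategyP step x : ~ normal_form step x -> step x (strategy step x).
Proof. by rewrite /strategy; case: pselect => // h _; case: cid. Qed.

Lemma lift_strategy step x : lift_rel step (dirac_fdist x) (strategy step x).
Proof.
have [nf|nnf] := pselect (normal_form step x).
  by rewrite strategy_nf //; exact: lift_nf.
by apply: lift_step; exact: strategyP.
Qed.

Definition run step mu n := iter n (fun m => bind_fdist m (strategy step)) mu.

Lemma lift_run step mu n : lift_rel step (run step mu n) (run step mu n.+1).
Proof. by apply: lift_bind => x _; exact: lift_strategy. Qed.

Lemma lift_seq_run step x : lift_seq step x (run step (dirac_fdist x)).
Proof. by split=> // n; exact: lift_run. Qed.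

End Strategies.

(** * Probability of normalising within a given number of steps *)

Section Termination.
Variables (R : realType) (Sigma V : countType) (ar : Sigma -> nat).
Local Notation tm := (term ar V).
Variable P : set (rule R V ar).
Hypothesis ptrs : is_ptrs P.
Hypothesis orth : orthogonal_ptrs P.
Local Notation full := (full_step P).
Local Notation innermost := (innermost_step P).

Fixpoint term_prob (n : nat) (s : tm) : R :=
  if n is n'.+1 then expect (strategy innermost s) (term_prob n')
  else (`[< normal_form full s >])%:R.

Lemma nf_prob_run mu n :
  nf_prob full (run innermost mu n) = expect mu (term_prob n).
Proof.
(* The run appends steps at its end whereas [term_prob] unfolds the first step, so the induction
   needs [term_prob m] for arbitrary [m] in place of [term_prob 0]. *)
rewrite nf_probE -/(term_prob 0) -[n in RHS]addn0.
elim: n (0%N) => [//|n IH] m.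
by rewrite /run iterS expect_bind addSnnS -IH.
Qed.

Lemma term_prob_nf n s : normal_form full s -> term_prob n s = 1.
Proof.
move=> nfs; elim: n => [|n IH] /=; first by rewrite asboolT.
by rewrite strategy_nf ?nf_innermost // expect_dirac.
Qed.

Lemma term_prob0 s nu : full s nu -> term_prob 0 s = 0.
Proof. by move=> snu /=; rewrite asboolF //; apply; exists nu. Qed.

Lemma term_prob_ge0 n s : 0 <= term_prob n s.
Proof.
elim: n s => [s /=|n IH s /=]; first exact: ler0n.
by rewrite -[leLHS](expect_cst (strategy innermost s)) le_expect.
Qed.

Lemma term_probS n s : term_prob n s <= term_prob n.+1 s.
Proof.
elim: n s => [|n IH] s; last by apply: le_expect => x _; exact: IH.
have [nf|nnf] := pselect (normal_form full s); first by rewrite !term_prob_nf.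
by rewrite {1}/term_prob asboolF // term_prob_ge0.
Qed.

(** By the diamond, both steps continue to the same two-step outcomes. The induction hypothesis
    replaces the chosen strategy step by the closing step of the diamond, and exchanging the finite
    sums finishes. For [n = 0] neither step of a proper diamond yields a normal form. *)
Lemma expect_innermost_unique n s nu1 nu2 : innermost s nu1 -> innermost s nu2 ->
  expect nu1 (term_prob n) = expect nu2 (term_prob n).
Proof.
elim: n s nu1 nu2 => [|n IH] s nu1 nu2 [d1 s1 i1] [d2 s2 i2].
all: have [->//|[G [mu1 [g1 [mu2 [g2 [-> -> G1 G2]]]]]]] :=
  inner_diamond ptrs orth s1 s2 i1 i2; rewrite !expect_map.
  rewrite (@eq_expect _ _ _ _ (fun=> 0)); last first.
    by move=> r _; apply: term_prob0 (innermost_full (G1 r)).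
  rewrite (@eq_expect _ _ mu2 _ (fun=> 0)) ?expect_cst //.
  by move=> r _; apply: term_prob0 (innermost_full (G2 r)).
have F1 r : term_prob n.+1 (g1 r) = expect mu2 (fun r2 => term_prob n (G r r2)).
  rewrite -(expect_map (G r)); apply: IH (G1 r).
  by apply: strategyP => nf; apply: nf; eexists; exact: (G1 r).
have F2 r : term_prob n.+1 (g2 r) = expect mu1 (fun r1 => term_prob n (G r1 r)).
  rewrite -(expect_map (G^~ r)); apply: IH (G2 r).
  by apply: strategyP => nf; apply: nf; eexists; exact: (G2 r).
rewrite (eq_expect (fun r _ => F1 r)) (eq_expect (fun r _ => F2 r)).
exact: expect_exchange.
Qed.

Lemma term_prob_innermost n s nu : innermost s nu ->
  term_prob n.+1 s = expect nu (term_prob n).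
Proof.
move=> snu; apply: (expect_innermost_unique _ _ snu).
by apply: strategyP => nf; apply: nf; exists nu.
Qed.

(** [S] abstracts the reachable terms: it is closed under full steps, and every step from it is
    spare. *)
Variable S : set tm.
Hypothesis S_spare : forall s d nu, S s -> step_at P d s nu -> spare_redex P d.
Hypothesis S_closed : forall s nu r, S s -> full s nu -> fdist_supp nu r -> S r.

(** The chosen innermost step is postponed until after the full step: the induction hypothesis
    applies to the full step from each [g2 r], and the two sums are exchanged. Where the full step
    erases the innermost redex, a step is saved, and monotonicity in [n] absorbs it. *)
Lemma term_prob_full n s nu : S s -> full s nu ->
  term_prob n.+1 s <= expect nu (term_prob n).
Proof.
elim: n s nu => [|n IH] s nu Ss [d1 s1].
all: have [nu2 sn2] : exists nu2, innermost s nu2 by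
  apply: full_innermost; exists nu, d1.
all: rewrite (term_prob_innermost _ sn2); have [d2 s2 i2] := sn2.
all: have [->//|[G [mu1 [g1 [mu2 [g2 [nu_eq nu2_eq G1 G2]]]]]]] :=
  spare_commute ptrs orth s1 s2 (S_spare Ss s1) i2; rewrite nu_eq nu2_eq !expect_map.
  rewrite (@eq_expect _ _ mu2 _ (fun=> 0)); last first.
    by move=> r _; apply: term_prob0 (G2 r).
  rewrite -[leLHS]/(expect mu2 (fun=> 0)) expect_cst -[leLHS](expect_cst mu1).
  by apply: le_expect => r _; exact: term_prob_ge0.
have Sg2 r : fdist_supp mu2 r -> S (g2 r).
  move=> r2; apply: (S_closed Ss (innermost_full sn2)).
  by rewrite nu2_eq; apply/fdist_supp_map; exists r.
apply: (@le_trans _ _ (expect mu2 (fun r2 => expect mu1 (fun r1 => term_prob n (G r1 r2))))).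
  apply: le_expect => r /Sg2 Sr; rewrite -(expect_map (G^~ r)).
  exact: IH (G2 r).
rewrite expect_exchange; apply: le_expect => r r1.
have [Gr|inn] := G1 _ r1.
  rewrite (@eq_expect _ _ _ _ (fun=> term_prob n (g1 r))) => [|r' _]; last by rewrite Gr.
  by rewrite expect_cst term_probS.
by rewrite (term_prob_innermost _ inn) expect_map.
Qed.

Lemma term_prob_lift n mu nu : (forall x, fdist_supp mu x -> S x) ->
  lift_rel full mu nu -> expect mu (term_prob n.+1) <= expect nu (term_prob n).
Proof.
move=> Smu l; elim: l Smu => {mu nu} [t nf|t nu tnu|k p mus nus mu nu p0 p1 _ IH emu enu] Smu.
- by rewrite !expect_dirac !term_prob_nf.
- rewrite expect_dirac; apply: term_prob_full tnu; apply: Smu.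
  by exists 1; rewrite in_mset1 eqxx.
- rewrite (expect_union _ emu) (expect_union _ enu); apply: ler_sum => j _.
  rewrite ler_pM2l //; apply: IH => x xj; apply: Smu.
  by apply/(fdist_supp_union _ emu); exists j.
Qed.

End Termination.

(** * Reachable terms and comparison with the innermost run *)

Section Reachability.
Variables (R : realType) (Sigma V : countType) (ar : Sigma -> nat).
Local Notation tm := (term ar V).
Variable P : set (rule R V ar).
Local Notation full := (full_step P).

Definition reachable : set tm := [set s | exists t mu n,
  [/\ basic_term P t, lift_seq full t mu & fdist_supp (mu n) s]].

(** Spareness speaks of infinite sequences from basic terms. Embedding any step of a reachable term
    in such a sequence turns it into a property of single steps. *)
Lemma reachable_step s d nu : reachable s -> step_at P d s nu ->
  exists t mu n, [/\ basic_term P t, lift_seq full t mu,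
    lift_uses P d (mu n) (mu n.+1) &
    forall r, fdist_supp nu r -> fdist_supp (mu n.+1) r].
Proof.
move=> [t [mu [n [bt [mu0 muS] [p ps]]]]] sd.
(* All occurrences of [s] take the step [d]; every other term follows an arbitrary strategy. *)
pose g x := if x == s then nu else strategy full x.
have lg x : lift_rel full (dirac_fdist x) (g x).
  rewrite /g; case: eqVneq => [->|_]; last exact: lift_strategy.
  by apply: lift_step; exists d.
(* Follow [mu] up to index [n], perform the step given by [g], then continue forever by the
   strategy. *)
pose mu' k := if (k <= n)%N then mu k
  else run full (bind_fdist (mu n) g) (k - n.+1).
have mu'n : mu' n = mu n by rewrite /mu' leqnn.
have mu'n1 : mu' n.+1 = bind_fdist (mu n) g by rewrite /mu' ltnn subnn.
exists t, mu', n; split=> //.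
- split; first by rewrite /mu' leq0n.
  move=> k; rewrite /mu'; case: (ltngtP k n) => [kn|nk|->].
  + exact: muS.
  + by rewrite subSn //; exact: lift_run.
  + by rewrite subnn; apply: lift_bind => x _.
- rewrite mu'n mu'n1; have [j0 j0E] := seq_tnthP ps.
  apply: (uses_union (j0 := j0)
    (nus := fun j => g (tnth (in_tuple (fdist_mset (mu n))) j).2)
    (@entry_gt0 _ _ (mu n)) (sum_entry (mu n)) _ (bind_dirac (mu n))) => [j||] //.
  by rewrite -j0E /= /g eqxx; exact: uses_step.
- move=> r nur; rewrite mu'n1; apply/fdist_supp_bind; exists s; first by exists p.
  by rewrite /g eqxx.
Qed.

Lemma reachable_closed s nu r :
  reachable s -> full s nu -> fdist_supp nu r -> reachable r.
Proof.
move=> rs [d sd] nur; have [t [mu [n [bt lt _ h]]]] := reachable_step rs sd.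
by exists t, mu, n.+1; split=> //; exact: h.
Qed.

Lemma reachable_spare : spare P ->
  forall s d nu, reachable s -> step_at P d s nu -> spare_redex P d.
Proof.
move=> sp s d nu rs sd; have [t [mu [n [bt lt u _]]]] := reachable_step rs sd.
exact: sp bt _ lt n _ u.
Qed.

Lemma lift_innermost_full mu nu :
  lift_rel (innermost_step P) mu nu -> lift_rel full mu nu.
Proof.
elim=> {mu nu} [t nf|t nu tnu|k p mus nus mu nu p0 p1 _ IH emu enu].
- by apply: lift_nf; rewrite -nf_innermost.
- by apply: lift_step; exact: innermost_full.
- exact: lift_union p0 p1 IH emu enu.
Qed.

Lemma lift_seq_innermost_full t mu :
  lift_seq (innermost_step P) t mu -> lift_seq full t mu.
Proof. by case=> mu0 muS; split=> // n; exact/lift_innermost_full/muS. Qed.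

Lemma nf_prob_innermost : nf_prob (innermost_step P) = nf_prob full.
Proof. by rewrite /nf_prob nf_innermost. Qed.

Lemma edl_innermost : edl (innermost_step P) = edl full.
Proof. by rewrite /edl nf_prob_innermost. Qed.

Hypotheses (ptrs : is_ptrs P) (orth : orthogonal_ptrs P) (sp : spare P).

(** The quantity [expect (mu k) (term_prob P (n - k))] does not decrease in [k]. It is the value for
    the innermost run at [k = 0] and for [mu n] at [k = n]. *)
Lemma innermost_run_slowest t mu n : basic_term P t -> lift_seq full t mu ->
  nf_prob full (run (innermost_step P) (dirac_fdist t) n) <= nf_prob full (mu n).
Proof.
move=> bt lt; rewrite nf_prob_run.
suff h k : (k <= n)%N ->
    expect (dirac_fdist t) (term_prob P n) <= expect (mu k) (term_prob P (n - k)).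
  by rewrite [leRHS]nf_probE; have := h n (leqnn n); rewrite subnn.
elim: k => [|k IH] kn; first by rewrite subn0 lt.1.
apply: (le_trans (IH (ltnW kn))); rewrite -(subnSK kn).
apply: (term_prob_lift ptrs orth (reachable_spare sp) (@reachable_closed) _ _ (lt.2 k)).
by move=> x xk; exists t, mu, k.
Qed.

Lemma edl_innermost_run t mu : basic_term P t -> lift_seq full t mu ->
  (edl full mu <= edl full (run (innermost_step P) (dirac_fdist t)))%E.
Proof.
move=> bt lt; apply: lee_nneseries => n _.
  by move=> _; rewrite lee_fin subr_ge0 nf_prob_le1.
by rewrite lee_fin lerD2l lerN2; exact: innermost_run_slowest.
Qed.

End Reachability.

Theorem theorem5p13 (R : realType) (Sigma V : countType) (ar : Sigma -> nat)
    (P : set (rule R V ar)) :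
  is_ptrs P -> orthogonal_ptrs P -> spare P ->
  [/\ AST (full_step P) (basic_term P) <->
        AST (innermost_step P) (basic_term P),
      PAST (full_step P) (basic_term P) <->
        PAST (innermost_step P) (basic_term P) &
      SAST (full_step P) (basic_term P) <->
        SAST (innermost_step P) (basic_term P)].
Proof.
move=> ptrs orth sp.
have run_seq t := lift_seq_run (innermost_step P) t.
split; split=> X t bt.
(* From full to innermost, sequences are merely included, with the same normal forms. Conversely,
   the hypothesis is applied to the single innermost run from [t], which bounds every full
   sequence. *)
- move=> mu /lift_seq_innermost_full; rewrite nf_prob_innermost; exact: X.
- move=> mu lmu; have := X t bt _ (run_seq t).
  rewrite nf_prob_innermost => cvg_run.
  apply: squeeze_cvgr cvg_run (cvg_cst (1 : R)).
  apply: nearW => n; rewrite nf_prob_le1 andbT.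
  exact: innermost_run_slowest.
- move=> mu /lift_seq_innermost_full; rewrite edl_innermost; exact: X.
- move=> mu lmu; apply: le_lt_trans (X t bt _ (run_seq t)).
  by rewrite edl_innermost; exact: edl_innermost_run.
- apply: le_lt_trans (X t bt); apply: le_ereal_sup => _ [mu lmu <-].
  by rewrite edl_innermost; exists mu => //; exact: lift_seq_innermost_full.
- apply: le_lt_trans (X t bt); apply: ge_ereal_sup => _ [mu lmu <-].
  apply: le_trans (edl_innermost_run ptrs orth sp bt lmu) _.
  apply: ereal_sup_ubound; exists (run (innermost_step P) (dirac_fdist t)) => //.
  by rewrite edl_innermost.
Qed.
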